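(* Let $d\ge2$ be even, let $\sigma_1,\dots,\sigma_d\in\mathbb{C}\setminus\mathbb{R}$ be distinct support points with $\sigma_{j+1}=\overline{\sigma_j}$ for $j$ odd, and let $\xi_1,\dots,\xi_d\in\mathbb{C}$ be nonzero weights with $\xi_{j+1}=\overline{\xi_j}$ for $j$ odd. Let $L_4(s)$ be the $d\times d$ pencil defined in the context. Then the dual linear basis consisting of the last $d-1$ rows of $L_4(s)$ has full rank, i.e., these $d-1$ rows form a $(d-1)\times d$ matrix of rank $d-1$ for all $s\in\mathbb{C}\cup\{\infty\}$ (where at $s=\infty$ the matrix is replaced by the coefficient matrix of $s$).
   Context: Let $r$ be a rational function with $r(\overline s)=\overline{r(s)}$ of the form $r=\sum_{j=1}^d r(\sigma_j)\phi_j$, where $\phi_j(s)=\frac{\xi_j/(s-\sigma_j)}{\sum_{i=1}^d\xi_i/(s-\sigma_i)}$. Let $$T=\begin{bmatrix}1&1\\ \imath&-\imath\end{bmatrix},\qquad T^{-1}=\frac12\begin{bmatrix}1&-\imath\\1&\imath\end{bmatrix},$$ $$L_{k,l}(s)=\begin{bmatrix}\xi_k(\sigma_l-s)&0\\0&\overline{\xi_k}(\overline{\sigma_l}-s)\end{bmatrix},\qquad h_l(s)^T=\begin{bmatrix}\overline{\xi_l}(\sigma_l-s)&\xi_l(s-\overline{\sigma_l})\end{bmatrix}.$$ Let $B(s)$ be the $(d-1)\times d$ pencil, with columns grouped in pairs $(1,2),(3,4),\dots,(d-1,d)$, whose block rows are as follows. For $j=1,3,\dots,d-3$ there is a block row with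 two rows having the block $-L_{j+2,j}(s)$ in the column pair $(j,j+1)$, the block $L_{j,j+2}(s)$ in the column pair $(j+2,j+3)$, and zeros elsewhere. The last row is $-h_{d-1}(s)^T$ in the column pair $(d-1,d)$ and zero elsewhere. Let $$Q(s)=\mathrm{diag}(\underbrace{T,\dots,T}_{d/2-1},-\imath)\;B(s)\;\mathrm{diag}(\underbrace{T^{-1},\dots,T^{-1}}_{d/2}),$$ which has real coefficient matrices, and denote its columns by $q_1(s),\dots,q_d(s)$. These columns correspond to the real basis functions $(\psi_1,\dots,\psi_d)^T=\mathrm{diag}(T,\dots,T)(\phi_1,\dots,\phi_d)^T$, which satisfy $\psi_1+\psi_3+\cdots+\psi_{d-1}=1$. Put $\rho_j=\mathrm{Re}(r(\sigma_j))$ and $\eta_j=\mathrm{Im}(r(\sigma_j))$. The pencil $L_4(s)$ is obtained by eliminating $\psi_{d-1}=1-\psi_1-\psi_3-\cdots-\psi_{d-3}$. Its columns correspond to the functions $1,\psi_1,\psi_2,\dots,\psi_{d-2},\psi_d$. Its first row is $$\begin{matrix}\rho_{d-1}&\rho_1-\rho_{d-1}&\eta_1&\cdots&\rho_{d-3}-\rho_{d-1}&\eta_{d-3}&\eta_{d-1}\end{matrix}$$ and its last $d-1$ rows are $$\begin{bmatrix}q_{d-1}&q_1-q_{d-1}&q_2&q_3-q_{d-1}&q_4&\cdots&q_{d-3}-q_{d-1}&q_{d-2}&q_d\end{bmatrix}.$$ These last $d-1$ rows form a dual linear basis in the sense that they annihilate $(1,\psi_1,\dots,\psi_{d-2},\psi_d)^T$.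 *)

(* Defs.v *)
From mathcomp Require Import all_boot all_order all_algebra.
From mathcomp Require Export reals.
From mathcomp.real_closed Require Export complex.

Set Implicit Arguments.
Unset Strict Implicit.
Unset Printing Implicit Defensive.

Import GRing.Theory Num.Theory.
Local Open Scope ring_scope.

(* Matrix pencils are matrices over {poly C} with entries of degree at most 1.
   Families sigma_1, ..., sigma_d and xi_1, ..., xi_d are functions on nat of
   which only the values at 1, ..., d are relevant. Row and column numbers of
   matrices are ordinals, hence start at 0: column c : 'I_d of B or Q carries
   the 1-based index c.+1, and the pairs (1,2), (3,4), ... are the pairs of
   columns sharing the same value of c./2. *)

Section RationalFunctions.
Variable F : fieldType.

(* Value of a rational function at s, computed on a representative in lowest
   terms; at a pole it is 0 by the convention x / 0 = 0. *)
Definition rateval (r : {fraction {poly F}}) (s : F) : F :=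
  let p := \n_(generic_quotient.repr r) in
  let q := \d_(generic_quotient.repr r) in
  (p %/ gcdp p q).[s] / (q %/ gcdp p q).[s].

Lemma ratevalE (p q : {poly F}) (s : F) :
  q.[s] != 0 -> rateval (tofrac p / tofrac q) s = p.[s] / q.[s].
Proof.
move=> qs0; have q0 : q != 0 by apply: contraNneq qs0 => ->; rewrite horner0.
set r := tofrac p / tofrac q; rewrite /rateval.
set x := generic_quotient.repr r.
have x20 : \d_x != 0 := denom_ratioP x.
have rE : r = tofrac \n_x / tofrac \d_x.
  apply/(mulIf (x := tofrac \d_x)); first by rewrite tofrac_eq0.
  rewrite mulfVK ?tofrac_eq0 // -[LHS]/(FracField.mul r (tofrac \d_x)).
  rewrite -[r]generic_quotient.reprK -/x; unlock FracField.tofrac.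
  rewrite -[LHS]FracField.pi_mul; apply/generic_quotient.eqmodP.
  rewrite /= FracField.equivfE /FracField.mulf.
  by rewrite !numden_Ratio ?mulr1 ?oner_neq0 // mulrC.
have E : p * \d_x = \n_x * q.
  have : r * tofrac q * tofrac \d_x = tofrac (p * \d_x).
    by rewrite /r mulfVK ?tofrac_eq0 // rmorphM.
  rewrite rE mulrAC mulfVK ?tofrac_eq0 // -rmorphM.
  by move/eqP; rewrite tofrac_eq => /eqP.
set a := \n_x in E *; set b := \d_x in E x20 *.
set g := gcdp a b.
have g0 : g != 0 by rewrite gcdp_eq0 negb_and x20 orbT.
have aE : a = a %/ g * g by rewrite divpK // dvdp_gcdl.
have bE : b = b %/ g * g by rewrite divpK // dvdp_gcdr.
have E' : p * (b %/ g) = (a %/ g) * q.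
  by apply/(mulIf g0); rewrite -mulrA -bE mulrAC -aE.
have cop : coprimep (b %/ g) (a %/ g).
  by rewrite coprimep_sym coprimep_div_gcd // x20 orbT.
have bq : (b %/ g) %| q.
  by rewrite -(Gauss_dvdpr _ cop) -E' dvdp_mull.
have b0 : (b %/ g).[s] != 0.
  apply: contra qs0 => /eqP bs; case/dvdpP: bq => h ->.
  by rewrite hornerM bs mulr0.
by apply/eqP; rewrite eqr_div // -!hornerM E' .
Qed.

End RationalFunctions.

Section DualBasis.
Variable C : numClosedFieldType.

Definition mx22 (K : Type) (a b c e : K) : 'M[K]_2 :=
  \matrix_(i, j) if i == 0 then (if j == 0 then a else b)
                 else (if j == 0 then c else e).

(* position (0 or 1) inside its pair of the row or column with number c *)
Definition par (c : nat) : 'I_2 := inord (odd c).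

Definition T : 'M[C]_2 := mx22 1 1 'i (- 'i).

Lemma invT : invmx T = 2^-1 *: mx22 1 (- 'i) 1 'i.
Proof.
suff TV : T *m (2^-1 *: mx22 1 (- 'i) 1 'i) = 1%:M.
  have [uT _] := mulmx1_unit TV.
  by rewrite -[LHS]mulmx1 -TV mulmxA mulVmx // mul1mx.
have ii (x : C) : 'i * (x * 'i) = - x by rewrite mulrCA -expr2 sqrCi mulrN1.
have h (x : C) : x = 2^-1 * x + 2^-1 * x.
  by rewrite -mulrDr -mulr2n -(mulr_natl x) mulKf // pnatr_eq0.
apply/matrixP=> i j; rewrite !mxE !big_ord_recl big_ord0 !mxE /=.
case: i => [[|[|//]] ?]; case: j => [[|[|//]] ?];
  by rewrite /= ?(mulrN, mulNr) ?ii ?(mul1r, mulr1, opprK, addr0, subrr, addNr)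
             // [RHS]h mulr1.
Qed.

Section Pencils.
Variables (d : nat) (sigma xi : nat -> C).

Definition Lblock (k l : nat) : 'M[{poly C}]_2 :=
  mx22 ((xi k)%:P * ((sigma l)%:P - 'X)) 0
       0 ((xi k)^*%:P * ((sigma l)^*%:P - 'X)).

Definition hrow (l : nat) : 'rV[{poly C}]_2 :=
  \row_j if j == 0 then (xi l)^*%:P * ((sigma l)%:P - 'X)
         else (xi l)%:P * ('X - (sigma l)^*%:P).

(* Rows i < d - 2 come in pairs: the pair i./2 is the block row of the odd
   index j = 2 * i./2 + 1. *)
Definition Bpencil : 'M[{poly C}]_(d.-1, d) :=
  \matrix_(i, c)
    if i == d.-2 :> nat then
      (if c./2 == d.-2./2 then - hrow d.-1 0 (par c) else 0)
    else
      let j := i./2.*2.+1 in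
      if c./2 == i./2 then - Lblock j.+2 j (par i) (par c)
      else if c./2 == i./2.+1 then Lblock j j.+2 (par i) (par c)
      else 0.

(* diag(A, ..., A), for n even *)
Definition diag2 (n : nat) (A : 'M[C]_2) : 'M[C]_n :=
  \matrix_(i, j) if i./2 == j./2 then A (par i) (par j) else 0.

(* diag(T, ..., T, -i), for d even *)
Definition Tleft : 'M[C]_d.-1 :=
  \matrix_(i, j)
    if (i == d.-2 :> nat) || (j == d.-2 :> nat) then
      (if i == j then - 'i else 0)
    else diag2 d.-1 T i j.

Definition Qpencil : 'M[{poly C}]_(d.-1, d) :=
  map_mx polyC Tleft *m Bpencil *m map_mx polyC (diag2 d (invmx T)).

(* q_k for 1 <= k <= d *)
Definition qcol (k : nat) : 'cV[{poly C}]_d.-1 :=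
  \col_i oapp (Qpencil i) 0 (insub k.-1).

(* Substituting psi_(d-1) = 1 - psi_1 - psi_3 - ... - psi_(d-3) in
   \sum_(1 <= k <= d) v k * psi_k: coefficients of
   1, psi_1, ..., psi_(d-2), psi_d, listed by position c = 0, ..., d - 1. *)
Definition elimcoef (V : zmodType) (v : nat -> V) (c : nat) : V :=
  if c == 0%N then v d.-1
  else if c == d.-1 then v d
  else if odd c then v c - v d.-1
  else v c.

Definition dual_basis : 'M[{poly C}]_(d.-1, d) :=
  \matrix_(i, c) elimcoef qcol c i 0.

Definition first_row (r : {fraction {poly C}}) : 'rV[{poly C}]_d :=
  \row_c (elimcoef (fun k => if odd k then 'Re (rateval r (sigma k))
                             else 'Im (rateval r (sigma k.-1))) c)%:P.

(* d x d, since 1 + d.-1 = d for d > 0 *)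
Definition L4 (r : {fraction {poly C}}) : 'M[{poly C}]_(1 + d.-1, d) :=
  col_mx (first_row r) dual_basis.

Definition baryterm (j : nat) : {fraction {poly C}} :=
  tofrac (xi j)%:P / tofrac ('X - (sigma j)%:P).

Definition phi (j : nat) : {fraction {poly C}} :=
  baryterm j / \sum_(1 <= i < d.+1) baryterm i.

End Pencils.

Definition pencil_at m n (M : 'M[{poly C}]_(m, n)) (s : C) : 'M[C]_(m, n) :=
  map_mx (horner_eval s) M.

(* the coefficient matrix of s *)
Definition pencil_at_infty m n (M : 'M[{poly C}]_(m, n)) : 'M[C]_(m, n) :=
  map_mx (coefp 1) M.

End DualBasis.

(* Main.v *)
(* Column c of B has the common factor sigma_(c+1) - s, so B(s) = M Delta(s)
   with M constant and Delta(s) diagonal.  M is upper triangular with nonzero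
   diagonal, hence has independent rows, and it kills the vector
   (xi_1, ..., xi_d), which has no zero entry.  As the sigma_c are distinct, at
   most one entry of Delta(s) vanishes.  If u M Delta(s) = 0, then u M vanishes
   outside that position, and since it is orthogonal to (xi_1, ..., xi_d) it
   vanishes there too, so u = 0.  The other factors of the dual basis are
   constant and invertible; at infinity Delta(s) is replaced by -1. *)

Require Import Defs.
From mathcomp Require Import all_boot all_order all_algebra.
From mathcomp Require Import zify.
Import GRing.Theory Num.Theory.
Local Open Scope ring_scope.

(** * Row independence of triangular and diagonally scaled matrices *)

Lemma row_free_inj (F : fieldType) (m n : nat) (A : 'M[F]_(m, n)) :
  (forall u : 'rV_m, u *m A = 0 -> u = 0) -> row_free A.
Proof.
move=> injA; rewrite -kermx_eq0; apply/eqP/row_matrixP=> i; rewrite row0.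
by apply: injA; rewrite -row_mul mulmx_ker row0.
Qed.

(** Column [f i] serves as the pivot of row [i]: once the earlier coordinates of [u] vanish, column
    [f i] of [u *m A] is [u 0 i * A i (f i)], since the later rows are zero there. *)
Lemma row_free_upper_trig (F : fieldType) (m n : nat) (A : 'M[F]_(m, n))
    (f : 'I_m -> 'I_n) :
  (forall i, A i (f i) != 0) ->
  (forall i k : 'I_m, (i < k)%N -> A k (f i) = 0) -> row_free A.
Proof.
move=> Aii Aki; apply: row_free_inj => u uA0.
suff u0 (k : nat) (i : 'I_m) : i = k :> nat -> u 0 i = 0.
  by apply/rowP=> i; rewrite (u0 i) ?mxE.
elim/ltn_ind: k i => k IHk i ik; move/rowP/(_ (f i)): uA0.
rewrite !mxE (bigD1 i) //= big1 ?addr0 => [/eqP|j /negPf ji].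
  by rewrite mulf_eq0 (negPf (Aii i)) orbF => /eqP.
have [ij|ij|/val_inj/eqP] := ltngtP i j; last by rewrite eq_sym ji.
  by rewrite Aki ?mulr0.
by rewrite (IHk j) ?mul0r // -ik.
Qed.

Lemma row_free_mul_diag (F : fieldType) (m n : nat) (A : 'M[F]_(m, n))
    (x : 'cV_n) (e : 'rV_n) :
  row_free A -> A *m x = 0 -> (forall c, x c 0 != 0) ->
  (forall c c', e 0 c = 0 -> e 0 c' = 0 -> c = c') ->
  row_free (A *m diag_mx e).
Proof.
move=> freeA Ax0 x0 e0; apply: row_free_inj => u uAe.
apply/eqP; rewrite -(mulmx_free_eq0 u freeA); apply/eqP.
have we c : (u *m A) 0 c * e 0 c = 0.
  by move/rowP/(_ c): uAe; rewrite mulmxA mul_mx_diag !mxE.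
apply/rowP=> c; rewrite [RHS]mxE.
have /eqP := we c; rewrite mulf_eq0 => /orP[/eqP // | /eqP ec].
(* Here [e 0 c = 0], so every other coordinate of [u *m A] vanishes, and pairing with [x] isolates
   coordinate [c]. *)
have wx : (u *m A) *m x = 0 by rewrite -mulmxA Ax0 mulmx0.
move/matrixP/(_ 0 0): wx; rewrite mxE (bigD1 c) //= big1 => [|c' cc'].
  rewrite addr0 [RHS]mxE => /eqP.
  by rewrite mulf_eq0 (negPf (x0 c)) orbF => /eqP.
have /eqP := we c'; rewrite mulf_eq0 => /orP[/eqP -> | /eqP ec'].
  by rewrite mul0r.
by rewrite (e0 _ _ ec' ec) eqxx in cc'.
Qed.

(** * Invertibility of the block-diagonal factors *)

Section PairSums.
Variable C : numClosedFieldType.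

Lemma T_unit : T C \in unitmx.
Proof.
rewrite unitmxE (expand_det_row _ 0) !big_ord_recl big_ord0 /cofactor !det_mx11.
rewrite !mxE /= unitfE addr0 expr0 expr1 !mul1r mulN1r -opprD oppr_eq0.
by rewrite -mulr2n mulrn_eq0 /= neq0Ci.
Qed.

(** The bound puts both members of the pair of [i] in range; for odd [n] it excludes the unpaired
    last index. *)
Lemma sum_pair (V : nmodType) (n : nat) (i : 'I_n) (f : 'I_2 -> V) :
  (i./2.*2.+1 < n)%N ->
  \sum_(k < n) (if i./2 == k./2 then f (par k) else 0) = \sum_k f k.
Proof.
move=> lin; have lin0 : (i./2.*2 < n)%N by apply: ltnW.
rewrite -big_mkcond (bigD1 (Ordinal lin0)) /=; last by rewrite doubleK.
rewrite (bigD1 (Ordinal lin)) /=; last first.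
  by rewrite uphalf_double eqxx -val_eqE /=; lia.
rewrite big1 ?addr0 => [|k]; last by rewrite -!val_eqE /=; lia.
rewrite !big_ord_recl big_ord0 addr0; congr (f _ + f _); apply: val_inj;
  by rewrite /par /= inordK ?odd_double.
Qed.

Lemma par_eq (i j : nat) : i./2 = j./2 -> (par i == par j) = (i == j).
Proof. by move=> ij; rewrite -val_eqE /par /= !inordK; lia. Qed.

(** Stated entrywise so that it also serves size [d.-1], which is odd and whose last index has no
    partner. *)
Lemma diag2_mul_invT n (i j : 'I_n) : (i./2.*2.+1 < n)%N ->
  \sum_k diag2 n (T C) i k * diag2 n (invmx (T C)) k j = (i == j)%:R.
Proof.
move=> lin.
transitivity (\sum_(k < n) if i./2 == k./2 then
  (if i./2 == j./2 then T C (par i) (par k) * invmx (T C) (par k) (par j)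
   else 0) else 0).
  apply: eq_bigr => k _; rewrite !mxE.
  case: eqP => [->|_]; last by rewrite mul0r.
  by case: (_./2 == j./2); rewrite ?mulr0.
rewrite (sum_pair _ _ _ (fun k => if i./2 == j./2 then
  T C (par i) k * invmx (T C) k (par j) else 0)) //.
have [ij|ij] := eqVneq i./2 j./2.
  have /matrixP/(_ (par i) (par j)) := mulmxV T_unit.
  by rewrite !mxE par_eq.
rewrite big1 //; by case: eqVneq => // ij'; rewrite ij' eqxx in ij.
Qed.

Lemma diag2_invT_unit n : ~~ odd n -> diag2 n (invmx (T C)) \in unitmx.
Proof.
move=> n_even; suff: diag2 n (T C) *m diag2 n (invmx (T C)) = 1%:M.
  by case/mulmx1_unit.
apply/matrixP=> i j; rewrite !mxE diag2_mul_invT //.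
by have := ltn_ord i; lia.
Qed.

Lemma Tleft_unit d : ~~ odd d -> Tleft C d \in unitmx.
Proof.
move=> d_even.
(* The expected inverse: blocks of the inverse of [T], and corner ['i] because -i * i = 1. *)
pose S : 'M[C]_d.-1 := \matrix_(i, j)
  if (i == d.-2 :> nat) || (j == d.-2 :> nat) then (if i == j then 'i else 0)
  else diag2 d.-1 (invmx (T C)) i j.
suff: Tleft C d *m S = 1%:M by case/mulmx1_unit.
apply/matrixP=> i j; rewrite [LHS]mxE [RHS]mxE.
have [id2|id2] := eqVneq (i : nat) d.-2.
  rewrite (bigD1 i) //= big1 => [|k /negPf ki]; last first.
    by rewrite !mxE id2 eqxx /= eq_sym ki mul0r.
  rewrite !mxE id2 !eqxx /= addr0; case: eqP => _; last by rewrite mulr0.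
  by rewrite mulNr -expr2 sqrCi opprK.
have [jd2|jd2] := eqVneq (j : nat) d.-2.
  rewrite big1 => [|k _]; last first.
    rewrite !mxE jd2 eqxx !orbT (negPf id2) /=.
    have [kd2|kd2] := eqVneq (k : nat) d.-2; last first.
      by rewrite -[k == j]val_eqE /= jd2 (negPf kd2) mulr0.
    by rewrite -[i == k]val_eqE /= kd2 (negPf id2) mul0r.
  by rewrite -[i == j]val_eqE /= jd2 (negPf id2).
rewrite -diag2_mul_invT; last by have := ltn_ord i; lia.
apply: eq_bigr => k _; rewrite !mxE (negPf id2) (negPf jd2) orbF /=.
have [kd2|//] := eqVneq (k : nat) d.-2.
(* As d - 2 is even and i < d - 2, the corner index lies in no pair with [i]. *)
have ->: (i./2 == k./2) = false by have := ltn_ord i; lia.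
by rewrite -[i == k]val_eqE /= kd2 (negPf id2) !mul0r.
Qed.

End PairSums.

(** * The substitution for psi_(d-1) as a constant matrix *)

Section Elimination.
Variable d : nat.

(** [elimcoef] is linear in its family, hence a right multiplication; the predecessor turns 1-based
    indices into ordinals. *)
Definition elim_mx (K : nzRingType) : 'M[K]_d :=
  \matrix_(k, c) elimcoef d (fun l => (k == l.-1 :> nat)%:R) c.

Lemma mul_elim_mx (K : nzRingType) (v : 'I_d -> K) (c : 'I_d) :
  \sum_k v k * elim_mx K k c = elimcoef d (fun l => oapp v 0 (insub l.-1)) c.
Proof.
have vE (l : nat) : \sum_k v k * (k == l :> nat)%:R = oapp v 0 (insub l).
  case: insubP => [k _ <- | ld] /=.
    rewrite (bigD1 k) //= eqxx mulr1 big1 ?addr0 // => k' kk'.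
    by rewrite val_eqE (negPf kk') mulr0.
  rewrite big1 // => k _; case: eqP => [kl|_]; last by rewrite mulr0.
  by rewrite -kl ltn_ord in ld.
under eq_bigr do rewrite mxE.
rewrite /elimcoef; do 3?[case: ifP => _]; rewrite -?vE //.
by rewrite -sumrB; apply: eq_bigr => k _; rewrite mulrBr.
Qed.

Lemma map_elim_mx (C : fieldType) :
  map_mx polyC (elim_mx C) = elim_mx {poly C}.
Proof.
apply/matrixP=> k c; rewrite !mxE /elimcoef.
by do 3?[case: ifP => _]; rewrite ?polyCB !polyC_natr.
Qed.

Lemma elim_mx_free (F : fieldType) : (2 <= d)%N -> row_free (elim_mx F).
Proof.
move=> d_ge2; apply: row_free_inj => u uE0.
have uE (c : 'I_d) : elimcoef d (fun l => oapp (u 0) 0 (insub l.-1)) c = 0.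
  by rewrite -mul_elim_mx; move/rowP/(_ c): uE0; rewrite !mxE.
have d0 : (0 < d)%N by lia.
have d1 : (d.-1 < d)%N by lia.
(* Position 0 yields the coordinate of psi_(d-1), whose ordinal is d - 2; it then drops out of every
   difference. *)
have ud : oapp (u 0) 0 (insub d.-2) = 0 := uE (Ordinal d0).
apply/rowP=> i; rewrite [RHS]mxE.
have -> : u 0 i = oapp (u 0) 0 (insub (i : nat)) by rewrite valK.
have [->|i1] := eqVneq (i : nat) d.-1.
  have := uE (Ordinal d1); rewrite /elimcoef /= eqxx.
  by have ->: (d.-1 == 0)%N = false by lia.
have [->//|i2] := eqVneq (i : nat) d.-2.
have ci : (i.+1 < d)%N by have := ltn_ord i; lia.
have := uE (Ordinal ci); rewrite /elimcoef /= ud subr0.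
have ->: (i.+1 == d.-1)%N = false by lia.
by rewrite if_same.
Qed.

End Elimination.

(** * Factorization of the pencil *)

Section Factorization.
Variables (C : numClosedFieldType) (d : nat) (sigma xi : nat -> C).

Lemma dual_basisE :
  dual_basis d sigma xi =
  map_mx polyC (Tleft C d) *m Bpencil d sigma xi *m
  map_mx polyC (diag2 d (invmx (T C)) *m elim_mx d C).
Proof.
rewrite map_mxM mulmxA -/(Qpencil d sigma xi) map_elim_mx.
apply/matrixP=> i c; rewrite [RHS]mxE mul_elim_mx mxE /elimcoef.
by do 3?[case: ifP => _]; rewrite !mxE.
Qed.

(* At i = d - 2 the cap d.-1 produces the row coming from h_(d-1). *)
Definition bary_mx : 'M[C]_(d.-1, d) :=
  \matrix_(i, c) (xi i.+1 *+ (c == minn i.+2 d.-1 :> nat)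
                  - xi (minn i.+2 d.-1).+1 *+ (c == i :> nat)).

Hypotheses (d_ge2 : (2 <= d)%N) (d_even : ~~ odd d).

(** Conjugated parameters are the next members of the families, so each nonzero entry in column [c]
    is a constant times sigma_(c+1) - s; the reversed sign in [hrow] fits the sign pattern of
    [bary_mx]. *)
Lemma BpencilE :
  (forall j, (1 <= j <= d)%N -> odd j -> sigma j.+1 = (sigma j)^*) ->
  (forall j, (1 <= j <= d)%N -> odd j -> xi j.+1 = (xi j)^*) ->
  Bpencil d sigma xi =
  map_mx polyC bary_mx *m diag_mx (\row_(c < d) ((sigma c.+1)%:P - 'X)).
Proof.
move=> sigmaJ xiJ; apply/matrixP=> i c; rewrite mul_mx_diag !mxE.
have par0 n : (par n == 0) = ~~ odd n.
  by rewrite -val_eqE /par /= inordK //; case: (odd n).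
have [li lc] := (ltn_ord i, ltn_ord c).
have [id2|id2] := eqVneq (i : nat) d.-2.
  have -> : minn i.+2 d.-1 = d.-1 by lia.
  rewrite par0; have [c1|c1] := eqVneq (c : nat) d.-1.
    have -> : c./2 == d.-2./2 by lia.
    have -> : (c == i :> nat) = false by lia.
    have -> : odd c by lia.
    have d1 : d.-1 = i.+1 by lia.
    rewrite c1 -d1 mulr0n subr0 mulr1n /= sigmaJ; [|lia..].
    by rewrite -mulrN opprB.
  have [ci|ci] := eqVneq (c : nat) i.
    have -> : c./2 == d.-2./2 by lia.
    have -> : odd c = false by lia.
    have d1 : d.-1 = i.+1 by lia.
    by rewrite ci -d1 /= sub0r polyCN mulNr xiJ //; lia.
  have -> : (c./2 == d.-2./2) = false by lia.
  by rewrite mulr0n subrr mul0r.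
have -> : minn i.+2 d.-1 = i.+2 by lia.
rewrite /= /Lblock /mx22 !mxE !par0; have [ci|ci] := eqVneq (c : nat) i.
  have -> : c./2 == i./2 by lia.
  have -> : (c == i.+2 :> nat) = false by lia.
  rewrite ci sub0r mulr1n polyCN mulNr; have [i_odd|i_even] := boolP (odd i).
    (* For odd [i] the entry is the conjugated one of its block. *)
    have -> : i./2.*2.+1 = i by lia.
    by rewrite sigmaJ ?(xiJ i.+2) //=; lia.
  by have -> : i./2.*2.+1 = i.+1 by lia.
have [ci2|ci2] := eqVneq (c : nat) i.+2.
  have -> : (c./2 == i./2) = false by lia.
  have -> : c./2 == i./2.+1 by lia.
  rewrite ci2 /= negbK subr0 mulr1n; have [i_odd|i_even] := boolP (odd i).
    have -> : i./2.*2.+1 = i by lia.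
    by rewrite (sigmaJ i.+2) ?xiJ //=; lia.
  by have -> : i./2.*2.+1 = i.+1 by lia.
rewrite !mulr0n subrr mul0r.
(* The remaining columns of the two blocks are off-diagonal: the parities of [c] and [i] differ. *)
have [ci1|ci1] := eqVneq c./2 i./2.
  have -> : odd c = ~~ odd i by lia.
  by case: (odd i); rewrite oppr0.
have [ci3|//] := eqVneq c./2 i./2.+1.
have -> : odd c = ~~ odd i by lia.
by case: (odd i).
Qed.


(** Each row has two nonzero positions, carrying each other's weight with opposite signs, so the two
    products cancel. *)
Lemma bary_mx_ker : bary_mx *m (\col_(c < d) xi c.+1) = 0.
Proof.
apply/colP=> i; rewrite !mxE.
have li : (i < d)%N by have := ltn_ord i; lia.
have le : (minn i.+2 d.-1 < d)%N by lia.
under eq_bigr do rewrite !mxE mulrBl !mulrnAl !mulrb.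
rewrite sumrB -!big_mkcond /=.
rewrite (big_pred1 (Ordinal le)) // (big_pred1 (Ordinal li)) //=.
by rewrite mulrC subrr.
Qed.

Lemma bary_mx_free :
  (forall j, (1 <= j <= d)%N -> xi j != 0) -> row_free bary_mx.
Proof.
move=> xi0; have dd : (d.-1 <= d)%N by lia.
apply: (row_free_upper_trig _ _ _ _ (widen_ord dd)) => [i|i k ik];
  rewrite mxE /=.
  have li := ltn_ord i.
  have ->: (i == minn i.+2 d.-1 :> nat) = false by lia.
  by rewrite eqxx mulr0n sub0r oppr_eq0 xi0 //; lia.
have lk := ltn_ord k.
have ->: (i == minn k.+2 d.-1 :> nat) = false by lia.
have ->: (i == k :> nat) = false by lia.
by rewrite !mulr0n subr0.
Qed.

End Factorization.

(** * Rank at finite points and at infinity *)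

(** Taking the coefficient of s is not multiplicative, but it commutes with constant factors. *)
Lemma map_coefp1_mul (F : fieldType) (m n p q : nat)
    (A : 'M[F]_(m, n)) (P : 'M[{poly F}]_(n, p)) (B : 'M[F]_(p, q)) :
  map_mx (coefp 1) (map_mx polyC A *m P *m map_mx polyC B) =
  A *m map_mx (coefp 1) P *m B.
Proof.
apply/matrixP=> i j; rewrite !mxE raddf_sum; apply: eq_bigr => k _ /=.
rewrite !mxE coefMC coef_sum; congr (_ * _).
by apply: eq_bigr => l _; rewrite !mxE coefCM.
Qed.


Theorem lemma3 (R : realType) (d : nat) (sigma xi : nat -> R[i])
    (r : {fraction {poly R[i]}})
    (d_ge2 : (2 <= d)%N) (d_even : ~~ odd d)
    (sigma_nonreal : forall j : nat, (1 <= j <= d)%N -> sigma j \isn't Num.real)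
    (sigma_distinct : forall j k : nat, (1 <= j <= d)%N -> (1 <= k <= d)%N ->
       sigma j = sigma k -> j = k)
    (sigma_conj : forall j : nat, (1 <= j <= d)%N -> odd j ->
       sigma j.+1 = (sigma j)^*)
    (xi_neq0 : forall j : nat, (1 <= j <= d)%N -> xi j != 0)
    (xi_conj : forall j : nat, (1 <= j <= d)%N -> odd j ->
       xi j.+1 = (xi j)^*)
    (r_conj : forall s : R[i], rateval r s^* = (rateval r s)^*)
    (r_bary : r = \sum_(1 <= j < d.+1)
       tofrac (rateval r (sigma j))%:P * phi d sigma xi j) :
  (forall s : R[i],
     \rank (pencil_at (dsubmx (L4 d sigma xi r)) s) = d.-1) /\
  \rank (pencil_at_infty (dsubmx (L4 d sigma xi r))) = d.-1.
Proof.
set M := bary_mx R[i] d xi.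
set W := diag2 d (invmx (T R[i])) *m elim_mx d R[i].
have W_free : row_free W.
  rewrite /row_free mxrankMfree ?elim_mx_free //.
  by rewrite mxrank_unit ?diag2_invT_unit.
(* Covers both cases: [e] is the diagonal evaluated at s, or constantly -1 at infinity. *)
have rankE (e : 'rV_d) : (forall c c', e 0 c = 0 -> e 0 c' = 0 -> c = c') ->
    \rank (Tleft R[i] d *m (M *m diag_mx e) *m W) = d.-1.
  move=> e0; rewrite mxrankMfree // eqmxMfull ?row_full_unit ?Tleft_unit //.
  apply/eqP; apply: (row_free_mul_diag _ _ _ _ (\col_(c < d) xi c.+1)) => //.
  - exact: bary_mx_free.
  - exact: bary_mx_ker.
  - by move=> c; rewrite mxE xi_neq0 //= ltn_ord.
have col_neq0 (c : 'I_d) : (1 <= c.+1 <= d)%N by rewrite ltn_ord.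
rewrite /L4 col_mxKd dual_basisE BpencilE // -/M -/W; split=> [s|].
  have horner_polyC m n (A : 'M[R[i]]_(m, n)) :
      map_mx (horner_eval s) (map_mx polyC A) = A.
    by apply/matrixP=> i j; rewrite !mxE /horner_eval hornerC.
  rewrite /pencil_at !map_mxM /= !horner_polyC map_diag_mx rankE // => c c'.
  rewrite !mxE /= /horner_eval !(hornerD, hornerN, hornerC, hornerX).
  move=> /eqP; rewrite subr_eq0 => /eqP sc /eqP.
  rewrite subr_eq0 -sc => /eqP /sigma_distinct cc'.
  by apply/val_inj/succn_inj; rewrite cc'.
have diag1 : map_mx (coefp 1)
    (diag_mx (\row_(c < d) ((sigma c.+1)%:P - 'X))) = diag_mx (const_mx (-1)).
  apply/matrixP=> i j; rewrite !mxE /= coefMn coefB coefC coefX.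
  by rewrite sub0r.
(* The left constants are merged so that the diagonal is the only nonconstant factor. *)
rewrite /pencil_at_infty mulmxA -map_mxM map_coefp1_mul diag1 -(mulmxA _ M).
by rewrite rankE // => c c'; rewrite mxE => /eqP; rewrite oppr_eq0 oner_eq0.
Qed.
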